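(* Let $\gamma$ be a $3$-Frenet helix, with constant curvatures $\kappa,\tau$, parametrized by the arc length $s$ in $\mathbb{R}^3_1$, and let $r\ge2$. Then $\gamma$ is proper $r$-harmonic if and only if its normal vector field $N$ is space-like and $\kappa^2=\tau^2$.
   Context: $\mathbb{R}^3_1$ is $\mathbb{R}^3$ with the flat Lorentzian metric $\langle x,y\rangle=-x_1y_1+x_2y_2+x_3y_3$. Curves $\gamma:I\to\mathbb{R}^3_1$ ($I$ an open real interval) are smooth, nonnull, parametrized by arc length; $T=\gamma'$; $\nabla$ is the Levi-Civita connection. Put $\nabla_T^0T=T$, $\nabla_T^jT=\nabla_T(\nabla_T^{j-1}T)$. For $r\ge2$, a curve in a semi-Riemannian manifold is $r$-harmonic if $\tau_r(\gamma)=\nabla^{2r-1}_T T+\sum_{\ell=0}^{r-2}(-1)^\ell R(\nabla^{2r-3-\ell}_T T,\nabla^{\ell}_T T)T=0$, where $R$ is the curvature operator (here $R=0$), and proper $r$-harmonic if it is $r$-harmonic and not a geodesic. A $3$-Frenet curve is a curve admitting a frame $\{T,N,B\}$ along it with $\langle T,T\rangle=\epsilon_1$, $\langle N,N\rangle=\epsilon_2$, $\langle B,B\rangle=\epsilon_3$, each $\pm1$, mutually orthogonal, and $\nabla_TT=\epsilon_2kN$, $\nabla_TN=-\epsilon_1kT+\epsilon_3\tau B$, $\nabla_TB=-\epsilon_2\tau N$, where $k(s)>0$ and $\tau(s)$ is real valued ($B$ being chosen so that $\{T,N,B\}$ is positively oriented). It is a helix if the curvatures are constant, denoted $\kappa,\tau$.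 $N$ is space-like if $\epsilon_2=1$. *)

(* Defs.v *)
From HB Require Import structures.
From mathcomp Require Import all_boot all_order all_algebra.
From mathcomp Require Import all_classical all_reals all_analysis.

Set Implicit Arguments.
Unset Strict Implicit.
Unset Printing Implicit Defensive.

Import Order.TTheory GRing.Theory Num.Theory.
Import numFieldNormedType.Exports.

Local Open Scope classical_set_scope.
Local Open Scope ring_scope.

(* A semi-Riemannian metric on R^n is given in the standard global coordinates
   by its Gram matrix field g; tangent vectors are row vectors of components. *)

Section SemiRiemannian.
Context {R : realType} {n : nat}.
Implicit Types (g : 'rV[R]_n -> 'M[R]_n) (p u v w : 'rV[R]_n).
Implicit Types (gamma V : R -> 'rV[R]_n) (I : set R).

Definition inner g p u v : R := (u *m g p *m v^T) 0 0.

Definition partial (i : 'I_n) (f : 'rV[R]_n -> R) p : R :=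
  'D_(delta_mx 0 i) f p.

(* Christoffel symbols Gamma^k_{ij} of the Levi-Civita connection of g *)
Definition christoffel g (k i j : 'I_n) p : R :=
  2^-1 * \sum_(l < n) invmx (g p) k l *
    (partial i (fun q => g q j l) p + partial j (fun q => g q i l) p
     - partial l (fun q => g q i j) p).

(* Components R^l_{kij} of the curvature operator, in the convention
   R(d_i, d_j) d_k = nabla_i nabla_j d_k - nabla_j nabla_i d_k
                   = \sum_l R^l_{kij} d_l. *)
Definition curvature_coef g (l k i j : 'I_n) p : R :=
  partial i (christoffel g l j k) p - partial j (christoffel g l i k) p
  + \sum_(m < n) (christoffel g l i m p * christoffel g m j k p
                  - christoffel g l j m p * christoffel g m i k p).

(* R(u, v) w at the point p *)
Definition curvature g p u v w : 'rV[R]_n :=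
  \row_l \sum_(i < n) \sum_(j < n) \sum_(k < n)
    curvature_coef g l k i j p * u 0 i * v 0 j * w 0 k.

(* nabla_T V, with T = gamma', for a vector field V along gamma *)
Definition covderiv g gamma V (s : R) : 'rV[R]_n :=
  derive1 V s + \row_k \sum_(i < n) \sum_(j < n)
    christoffel g k i j (gamma s) * derive1 gamma s 0 i * V s 0 j.

(* nabla_T^j T *)
Definition nablaT g gamma (j : nat) : R -> 'rV[R]_n :=
  iter j (covderiv g gamma) (derive1 gamma).

(* tau_r(gamma), for r >= 2 *)
Definition tension g (r : nat) gamma (s : R) : 'rV[R]_n :=
  nablaT g gamma (2 * r - 1) s +
  \sum_(0 <= l < r - 1) (-1) ^+ l *:
    curvature g (gamma s) (nablaT g gamma (2 * r - 3 - l) s)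
      (nablaT g gamma l s) (derive1 gamma s).

Definition r_harmonic g I (r : nat) gamma : Prop :=
  forall s, I s -> tension g r gamma s = 0.

Definition geodesic g I gamma : Prop :=
  forall s, I s -> covderiv g gamma (derive1 gamma) s = 0.

Definition proper_r_harmonic g I (r : nat) gamma : Prop :=
  r_harmonic g I r gamma /\ ~ geodesic g I gamma.

Definition smooth_on I V : Prop :=
  forall (m : nat) (s : R), I s -> derivable (derive1n m V) s 1.

(* for a nonnull curve *)
Definition arc_length_param g I gamma : Prop :=
  forall s, I s ->
    `| inner g (gamma s) (derive1 gamma s) (derive1 gamma s) | = 1.

End SemiRiemannian.

Definition open_interval {R : realType} (I : set R) : Prop :=
  [/\ open I, is_interval I & I !=set0].

(* <x, y> = - x_1 y_1 + x_2 y_2 + x_3 y_3, the coordinates being numbered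
   from 0 in 'rV_3 *)
Definition lorentz_metric {R : realType} : 'rV[R]_3 -> 'M[R]_3 :=
  fun=> diag_mx (\row_i (if i == 0 then -1 else 1)).

(* A curve in R^3 with the metric g, defined on I, together with a frame
   {T, N, B}, T = gamma', of causal characters eps1, eps2, eps3 and curvature
   functions k, tau. *)
Record frenet3 {R : realType} (g : 'rV[R]_3 -> 'M[R]_3) (I : set R)
    (gamma N B : R -> 'rV[R]_3) (eps1 eps2 eps3 : R) (k tau : R -> R) : Prop :=
  Frenet3 {
  frenet_smooth : [/\ smooth_on I gamma, smooth_on I N & smooth_on I B];
  frenet_arc_length : arc_length_param g I gamma;
  frenet_sign :
    [/\ eps1 = 1 \/ eps1 = -1, eps2 = 1 \/ eps2 = -1 & eps3 = 1 \/ eps3 = -1];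
  frenet_norm : forall s, I s ->
    [/\ inner g (gamma s) (derive1 gamma s) (derive1 gamma s) = eps1,
        inner g (gamma s) (N s) (N s) = eps2
      & inner g (gamma s) (B s) (B s) = eps3];
  frenet_orthogonal : forall s, I s ->
    [/\ inner g (gamma s) (derive1 gamma s) (N s) = 0,
        inner g (gamma s) (derive1 gamma s) (B s) = 0
      & inner g (gamma s) (N s) (B s) = 0];
  frenet_oriented : forall s, I s ->
    0 < \det (\matrix_(a < 3) nth 0 [:: derive1 gamma s; N s; B s] a);
  frenet_k_gt0 : forall s, I s -> 0 < k s;
  frenet_equations : forall s, I s ->
    [/\ covderiv g gamma (derive1 gamma) s = (eps2 * k s) *: N s,
        covderiv g gamma N s =
          - (eps1 * k s) *: derive1 gamma s + (eps3 * tau s) *: B s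
      & covderiv g gamma B s = - (eps2 * tau s) *: N s] }.

Definition frenet3_helix {R : realType} (g : 'rV[R]_3 -> 'M[R]_3) (I : set R)
    (gamma N B : R -> 'rV[R]_3) (eps1 eps2 eps3 kappa tau : R) : Prop :=
  frenet3 g I gamma N B eps1 eps2 eps3 (fun=> kappa) (fun=> tau).

(* Main.v *)
(** In flat space the covariant derivative along [gamma] is the ordinary one, so
    the Frenet equations give [N'' = - eps2 (eps1 kappa^2 + eps3 tau^2) N] and
    [nabla_T^(2r-1) T] is a nonzero multiple of
    [(eps1 kappa^2 + eps3 tau^2)^(r-1) N].  The Gram determinant of the frame
    gives [eps1 eps2 eps3 = -1] in Lorentzian signature, and this turns
    [eps1 kappa^2 + eps3 tau^2 = 0] into [eps2 = 1] and [kappa^2 = tau^2]. *)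
Require Import Defs.
From HB Require Import structures.
From mathcomp Require Import all_boot all_order all_algebra.
From mathcomp Require Import ring lra.
From mathcomp Require Import all_classical all_reals all_analysis.

Import Order.TTheory GRing.Theory Num.Theory.
Import numFieldNormedType.Exports.
Local Open Scope classical_set_scope.
Local Open Scope ring_scope.

Lemma partial_cst (R : realType) (n : nat) (i : 'I_n) (c : R) (p : 'rV[R]_n) :
  partial i (fun=> c) p = 0.
Proof. exact: derive_cst. Qed.

Lemma christoffel_cst (R : realType) (n : nat) (G : 'M[R]_n) (k i j : 'I_n) :
  christoffel (fun=> G) k i j = fun=> 0.
Proof.
apply/funext => p; rewrite /christoffel big1 ?mulr0 // => l _.
by rewrite !partial_cst addr0 subr0 mulr0.
Qed.

Lemma covderiv_cst (R : realType) (n : nat) (G : 'M[R]_n)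
    (gamma V : R -> 'rV[R]_n) :
  covderiv (fun=> G) gamma V = derive1 V.
Proof.
apply/funext => s; rewrite /covderiv; apply/rowP => k; rewrite !mxE.
rewrite big1 ?addr0 // => i _; rewrite big1 // => j _.
by rewrite christoffel_cst !mul0r.
Qed.

Lemma nablaTS_cst (R : realType) (n : nat) (G : 'M[R]_n)
    (gamma : R -> 'rV[R]_n) (j : nat) :
  nablaT (fun=> G) gamma j.+1 = derive1 (nablaT (fun=> G) gamma j).
Proof. exact: covderiv_cst. Qed.

Lemma curvature_cst (R : realType) (n : nat) (G : 'M[R]_n)
    (p u v w : 'rV[R]_n) :
  curvature (fun=> G) p u v w = 0.
Proof.
apply/rowP => l; rewrite !mxE.
rewrite big1 // => i _; rewrite big1 // => j _; rewrite big1 // => k _.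
rewrite /curvature_coef !christoffel_cst !partial_cst subr0 add0r big1 ?mul0r //.
by move=> m _; rewrite !christoffel_cst !mulr0 subr0.
Qed.

Lemma tension_cst (R : realType) (n : nat) (G : 'M[R]_n) (r : nat)
    (gamma : R -> 'rV[R]_n) (s : R) :
  tension (fun=> G) r gamma s = nablaT (fun=> G) gamma (2 * r - 1) s.
Proof.
by rewrite /tension big1 ?addr0 // => l _; rewrite curvature_cst scaler0.
Qed.

(** A derivative depends only on the germ at [s], and an open [I] is a neighbourhood of [s]. The
    Frenet equations hold on [I] alone, so this is what allows them to be differentiated again. *)
Lemma eq_on_derive1 (R : realType) (n : nat) (I : set R)
    (f g : R -> 'rV[R]_n) (s : R) :
  open I -> {in I, f =1 g} -> I s -> derive1 f s = derive1 g s.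
Proof.
move=> oI fg Is; rewrite !derive1E; apply: near_eq_derive.
near=> x; apply: fg; rewrite inE; near: x.
exact: open_nbhs_nbhs.
Unshelve. all: by end_near. Qed.

Lemma derive1Z (R : realType) (n : nat) (a : R) (f : R -> 'rV[R]_n) (s : R) :
  derivable f s 1 -> derive1 (fun x => a *: f x) s = a *: derive1 f s.
Proof. by move=> df; rewrite !derive1E deriveZ. Qed.

(** Differentiating [N] gives a combination of [T] and [B], and both of these differentiate back to
    multiples of [N]. Two derivatives thus multiply [N] by [a * b + c * d]. *)
Lemma nablaT_cst_odd (R : realType) (n : nat) (I : set R) (G : 'M[R]_n)
    (gamma N B : R -> 'rV[R]_n) (a b c d : R) :
  open I ->
  {in I, forall s, derivable (derive1 gamma) s 1} ->
  {in I, forall s, derivable N s 1} ->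
  {in I, forall s, derivable B s 1} ->
  {in I, forall s, derive1 (derive1 gamma) s = a *: N s} ->
  {in I, forall s, derive1 N s = b *: derive1 gamma s + c *: B s} ->
  {in I, forall s, derive1 B s = d *: N s} ->
  forall m : nat, {in I, forall s,
    nablaT (fun=> G) gamma m.*2.+1 s = ((a * b + c * d) ^+ m * a) *: N s}.
Proof.
move=> oI dT dN dB fT fN fB.
elim=> [|m IHm] s; rewrite inE => Is.
  by rewrite /nablaT/= covderiv_cst fT ?inE // expr0 mul1r.
set e := (a * b + c * d) ^+ m * a.
(* The intermediate derivative, of even order, lies in the span of [T] and [B]. *)
have D1 : {in I, derive1 (nablaT (fun=> G) gamma m.*2.+1) =1
    fun x => e *: (b *: derive1 gamma x + c *: B x)}.
  move=> x; rewrite inE => Ix.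
  rewrite (@eq_on_derive1 _ _ I _ _ _ oI IHm) // derive1Z ?fN ?inE //.
  exact/dN/mem_set.
rewrite doubleS 2!nablaTS_cst (@eq_on_derive1 _ _ I _ _ _ oI D1) //.
have dTs : derivable (derive1 gamma) s 1 by exact/dT/mem_set.
have dBs : derivable B s 1 by exact/dB/mem_set.
rewrite derive1Z; last by apply: derivableD; apply: derivableZ.
rewrite derive1E deriveD; [|exact: derivableZ..].
rewrite !deriveZ // -!derive1E fT ?inE // fB ?inE //.
by rewrite !scalerA -scalerDl scalerA exprS; congr (_ *: _); rewrite /e; ring.
Qed.

Lemma inner_sym (R : realType) (n : nat) (g : 'rV[R]_n -> 'M[R]_n)
    (p u v : 'rV[R]_n) :
  (g p)^T = g p -> inner g p u v = inner g p v u.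
Proof.
move=> gT.
by rewrite /inner -[u *m _ *m _]trmxK mxE !trmx_mul trmxK gT mulmxA.
Qed.

(** Take determinants in the Gram identity [F *m G *m F^T = diag(e1, e2, e3)], where [F] has rows
    [u], [v], [w] and the Lorentz matrix [G] has determinant -1. *)
Lemma lorentz_frame_sign (R : realType) (p u v w : 'rV[R]_3) (e1 e2 e3 : R) :
  inner lorentz_metric p u u = e1 -> inner lorentz_metric p v v = e2 ->
  inner lorentz_metric p w w = e3 ->
  inner lorentz_metric p u v = 0 -> inner lorentz_metric p u w = 0 ->
  inner lorentz_metric p v w = 0 ->
  e1 * e2 * e3 = - (\det (\matrix_(a < 3) nth 0 [:: u; v; w] a)) ^+ 2.
Proof.
move=> uu vv ww uv uw vw; set F := \matrix_(a < 3) _.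
have gT : (lorentz_metric p)^T = lorentz_metric p :> 'M[R]_3.
  exact: tr_diag_mx.
have gram : F *m lorentz_metric p *m F^T
    = diag_mx (\row_i nth 0 [:: e1; e2; e3] i).
  apply/matrixP => i j.
  have -> : (F *m lorentz_metric p *m F^T) i j
      = inner lorentz_metric p (row i F) (row j F).
    by rewrite /inner -row_mul !mxE; apply: eq_bigr => k _; rewrite !mxE.
  rewrite !rowK !mxE.
  (* Of the nine entries, those below the diagonal reduce to the hypotheses by symmetry of the
     metric. *)
  case: i => [[|[|[|//]]] ?]; case: j => [[|[|[|//]]] ?] //=;
    by rewrite ?mulr1n ?mulr0n // inner_sym.
have := congr1 determinant gram.
rewrite !det_mulmx det_tr !det_diag !big_ord_recl !big_ord0 !mxE /= => h.
by apply: etrans (etrans _ (esym h)) _ => /=; ring.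
Qed.

Theorem corollary1p13 (R : realType) (I : set R) (gamma N B : R -> 'rV[R]_3)
    (eps1 eps2 eps3 kappa tau : R) (r : nat) :
  open_interval I ->
  frenet3_helix lorentz_metric I gamma N B eps1 eps2 eps3 kappa tau ->
  (2 <= r)%N ->
  (proper_r_harmonic lorentz_metric I r gamma <->
   eps2 = 1 /\ kappa ^+ 2 = tau ^+ 2).
Proof.
move=> [oI _ [s0 Is0]] [[sg sN sB] _ [e1 e2 e3] norms orth pos k_gt0 eqs] r2.
have kgt0 := k_gt0 _ Is0.
have nz_eps (e : R) : e = 1 \/ e = -1 -> e != 0.
  by case=> ->; rewrite ?oppr_eq0 oner_eq0.
have eps_prod : eps1 * eps2 * eps3 < 0.
  have [? ? ?] := norms _ Is0; have [? ? ?] := orth _ Is0.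
  (* Positive orientation makes the determinant nonzero, so minus its square is strictly
     negative. *)
  rewrite (@lorentz_frame_sign R (gamma s0) (derive1 gamma s0) (N s0) (B s0)) //.
  by rewrite oppr_lt0 exprn_gt0 // pos.
have N0 : N s0 != 0.
  have [_ NN _] := norms _ Is0; apply: contraTneq (nz_eps _ e2) => N0.
  by rewrite -NN N0 /inner !mul0mx mxE eqxx.
have eqT : {in I, forall s, derive1 (derive1 gamma) s = (eps2 * kappa) *: N s}.
  by move=> s; rewrite inE => /eqs[+ _ _]; rewrite covderiv_cst.
have eqN : {in I, forall s, derive1 N s
    = (- (eps1 * kappa)) *: derive1 gamma s + (eps3 * tau) *: B s}.
  by move=> s; rewrite inE => /eqs[_ + _]; rewrite covderiv_cst.
have eqB : {in I, forall s, derive1 B s = (- (eps2 * tau)) *: N s}.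
  by move=> s; rewrite inE => /eqs[_ _]; rewrite covderiv_cst.
have dT : {in I, forall s, derivable (derive1 gamma) s 1}.
  by move=> s; rewrite inE; apply: (sg 1%N).
have dN : {in I, forall s, derivable N s 1}.
  by move=> s; rewrite inE; apply: (sN 0%N).
have dB : {in I, forall s, derivable B s 1}.
  by move=> s; rewrite inE; apply: (sB 0%N).
have not_geo : ~ geodesic lorentz_metric I gamma.
  move=> /(_ _ Is0); have [-> _ _] := eqs _ Is0 => /eqP.
  by rewrite scaler_eq0 (negPf N0) mulf_eq0 (negPf (nz_eps _ e2)) gt_eqF.
(* The factor gained by two derivatives, equal to [- eps2 * (eps1 * kappa ^+ 2 + eps3 * tau ^+
   2)]. *)
set c := eps2 * kappa * - (eps1 * kappa) + eps3 * tau * - (eps2 * tau).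
have tensionE s : I s -> tension lorentz_metric r gamma s
    = (c ^+ r.-1 * (eps2 * kappa)) *: N s.
  move=> Is; rewrite tension_cst.
  (* Subtraction is truncated: the identity fails at [r = 0], which [r2] excludes. *)
  have -> : (2 * r - 1 = r.-1.*2.+1)%N.
    by case: r r2 => // r _; rewrite mul2n doubleS subn1.
  by apply: (@nablaT_cst_odd _ _ I _ _ _ _ _ _ _ _ oI dT dN dB eqT eqN eqB); rewrite inE.
have harmE : r_harmonic lorentz_metric I r gamma <-> c = 0.
  split=> [/(_ _ Is0)|c0 s Is].
    rewrite tensionE // => /eqP; rewrite scaler_eq0 (negPf N0) orbF.
    rewrite !mulf_eq0 (negPf (nz_eps _ e2)) (gt_eqF kgt0) !orbF expf_eq0.
    by move=> /andP[_ /eqP].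
  (* Since [r >= 2], the exponent [r.-1] is positive and the power of zero vanishes. *)
  by rewrite tensionE // c0 expr0n -subn1 subn_eq0 leqNgt r2 mul0r scale0r.
(* If [c = 0], then [kappa > 0] forces [eps1] and [eps3] to be opposite, so [kappa ^+ 2 = tau ^+ 2],
   and the negative product of signs gives [eps2 = 1]. Conversely, [eps2 = 1] makes [eps1] and
   [eps3] opposite, and the two terms cancel. *)
have cE : c = 0 <-> eps2 = 1 /\ kappa ^+ 2 = tau ^+ 2.
  rewrite /c; clear -eps_prod kgt0 e1 e2 e3.
  have k2 : 0 < kappa ^+ 2 by rewrite exprn_gt0.
  have t2 : 0 <= tau ^+ 2 by rewrite sqr_ge0.
  case: e1 eps_prod => ->; case: e2 => ->; case: e3 => -> eps_prod;
    split=> [c0|[? kt]]; try split; nra.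
split=> [[/harmE/cE]|/cE/harmE] //.
Qed.
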